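(* Let $m\ge 2$ and let $A_1,\ldots,A_m\in\mathbb{M}_d$ be positive semidefinite. Define $C_1=A_1$ and, for $2\le j\le m$, $C_j=C_{j-1}\vee A_j$ and $D_j=C_{j-1}\wedge A_j$. Write $C=C_m=\bigvee_{j=1}^m A_j$ and $S=\sum_{j=1}^m A_j$. Then $$\|S\|_2^2-\|C\|_2^2=\sum_{j=2}^m\|D_j\|_2^2+2\sum_{1\le i<j\le m}\|A_i^{1/2}A_j^{1/2}\|_2^2 .$$
   Context: $\mathbb{M}_d$ is the algebra of complex $d\times d$ matrices, and $\|X\|_2=(\operatorname{Tr}X^*X)^{1/2}$ is the Hilbert–Schmidt (Frobenius) norm, with $\operatorname{Tr}$ the unnormalized trace. For a Hermitian $X\in\mathbb{M}_d$ and $t\in\mathbb{R}$, $E_X(t)=\mathbf{1}_{(t,\infty)}(X)$ is the orthogonal projection onto the span of the eigenvectors of $X$ with eigenvalue $>t$. The spectral order on Hermitian matrices is: $A\preceq B$ iff $E_A(t)\le E_B(t)$ for all $t\in\mathbb{R}$. With this order the Hermitian matrices in $\mathbb{M}_d$ form a lattice (Olson); $A\vee B$ and $A\wedge B$ denote the supremum (join) and infimum (meet). They are characterized by $E_{A\vee B}(t)=E_A(t)\vee E_B(t)$ and $E_{A\wedge B}(t)=E_A(t)\wedge E_B(t)$ for all $t\in\mathbb{R}$, where for orthogonal projections $P,Q$ the projections $P\vee Q$ and $P\wedge Q$ are the orthogonal projections onto $\operatorname{Ran}P+\operatorname{Ran}Q$ and $\operatorname{Ran}P\cap\operatorname{Ran}Q$,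 respectively. *)

(* Defs.v *)
From HB Require Import structures.
From mathcomp Require Import all_boot all_order all_algebra.
From mathcomp Require Import sesquilinear spectral.
From mathcomp Require Import boolp classical_sets reals.
From mathcomp Require Import complex.

Set Implicit Arguments.
Unset Strict Implicit.
Unset Printing Implicit Defensive.

Import Order.TTheory GRing.Theory Num.Theory.

Local Open Scope classical_set_scope.
Local Open Scope ring_scope.
Local Open Scope sesquilinear_scope.

Section SpectralOrder.
Variables (R : realType) (d : nat).
Implicit Types (X Y A B : 'M[R[i]]_d) (F : set 'M[R[i]]_d).

Definition psdmx X : Prop :=
  X \is hermsymmx /\ forall v : 'cV[R[i]]_d, 0 <= (v ^t* *m X *m v) 0 0.

(* The Loewner order; on orthogonal projections it is inclusion of ranges. *)
Definition loewner_le X Y : Prop := psdmx (Y - X).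

(* Functional calculus f(X) = U^-1 f(D) U, where X = U^-1 D U is the spectral
   decomposition (U unitary, D diagonal) of X. It is meant for normal X, for
   which the result does not depend on the chosen decomposition. *)
Definition mxfun (f : R[i] -> R[i]) X : 'M[R[i]]_d :=
  invmx (spectralmx X) *m diag_mx (map_mx f (spectral_diag X)) *m spectralmx X.

(* E_X(t) = 1_(t, +oo)(X); for z : R[i], t%:C < z forces z to be real. *)
Definition specproj X (t : R) : 'M[R[i]]_d :=
  mxfun (fun z => if t%:C%C < z then 1 else 0) X.

Definition sqrtmx X : 'M[R[i]]_d := mxfun sqrtC X.

Definition spec_le A B : Prop :=
  forall t : R, loewner_le (specproj A t) (specproj B t).

Definition is_spec_sup F X : Prop :=
  [/\ X \is hermsymmx,
      forall A, F A -> spec_le A X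
    & forall Y, Y \is hermsymmx -> (forall A, F A -> spec_le A Y) ->
        spec_le X Y].

Definition is_spec_inf F X : Prop :=
  [/\ X \is hermsymmx,
      forall A, F A -> spec_le X A
    & forall Y, Y \is hermsymmx -> (forall A, F A -> spec_le Y A) ->
        spec_le Y X].

(* The supremum and infimum among Hermitian matrices; 0 is a dummy value for
   sets F that have none. *)
Definition spec_sup F : 'M[R[i]]_d := xget 0 [set X | is_spec_sup F X].
Definition spec_inf F : 'M[R[i]]_d := xget 0 [set X | is_spec_inf F X].

Definition spec_join A B : 'M[R[i]]_d := spec_sup [set A; B].
Definition spec_meet A B : 'M[R[i]]_d := spec_inf [set A; B].

(* Hilbert-Schmidt norm, a nonnegative real element of R[i]. *)
Definition hsnorm X : R[i] := sqrtC (\tr (X ^t* *m X)).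

End SpectralOrder.

(* Main.v *)
Require Import Defs.
From mathcomp Require Import all_boot all_order all_algebra.
From mathcomp Require Import sesquilinear spectral.
From mathcomp Require Import boolp classical_sets reals.
From mathcomp Require Import complex ring.

Set Implicit Arguments.
Unset Strict Implicit.
Unset Printing Implicit Defensive.

Import Order.TTheory GRing.Theory Num.Theory.

Local Open Scope classical_set_scope.
Local Open Scope ring_scope.
Local Open Scope sesquilinear_scope.

(** Write E_X(t) for specproj X t. The map t |-> E_X(t) is a decreasing step
    function from 1 to 0 with jumps at the eigenvalues of X, so for every
    sorted list s_0 <= ... <= s_(n-1) of reals that contains these eigenvalues

      f(X) = sum_(i < n) f(s_i) (E_i - E_(i+1)),
      where E_0 = 1 and E_(i+1) = E_X(s_i)              [mxfun_layers].

    Thus X is determined by the projections E_X(t), which makes the spectral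
    order antisymmetric; and conversely every decreasing step family of
    subspaces, from the whole space to 0, consists of the ranges of the
    projections E_X(t) of some Hermitian X [specproj_realize]. Applied to the
    sums and to the intersections of the ranges of E_A(t) and E_B(t), this
    gives the join and the meet [spec_joinP, spec_meetP]. Since
    dim (U + V) + dim (U :&: V) = dim U + dim V, and since the trace of f(X)
    depends linearly on the ranks of the E_i, the displayed formula yields

      Tr f(A v B) + Tr f(A ^ B) = Tr f(A) + Tr f(B)     [mxtrace_join_meet].

    With f(z) = z^2, and summed over the successive joins C_j, this telescopes
    to  sum_j |A_j|^2 - |C_m|^2 = sum_(j >= 2) |D_j|^2.  Expanding the square
    |S|^2 adds the cross terms 2 Tr (A_i A_j), and these equal
    2 |A_i^(1/2) A_j^(1/2)|^2 by cyclicity of the trace.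

    Subspaces are represented as row spaces. The row space of a Hermitian matrix
    is the complex conjugate of its range, so inclusions, sums, intersections
    and dimensions are the same for both. *)

(** * Identities in rings *)

(** The step of the telescoping: joining the next matrix, of squared norm a,
    turns the squared norm c of the join into x and leaves that of the meet,
    y. *)
Lemma subr_exchange (V : zmodType) (s a c x y : V) :
  x + y = c + a -> s + a - x = s - c + y.
Proof.
by move=> e; apply/eqP; rewrite subr_eq -addrA (addrC y) e addrA subrK.
Qed.

(** Transfers the rank formula for projections, valid at every threshold, to the
    traces of functions of matrices, with c_i = f(s_i). *)
Lemma sum_jumpsD (K : pzRingType) n (c a b x y : nat -> K) :
  (forall k, x k + y k = a k + b k) ->
  \sum_(0 <= i < n) c i * (x i - x i.+1)
    + \sum_(0 <= i < n) c i * (y i - y i.+1)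
  = \sum_(0 <= i < n) c i * (a i - a i.+1)
    + \sum_(0 <= i < n) c i * (b i - b i.+1).
Proof.
move=> xyab; rewrite -!big_split; apply: eq_bigr => i _ /=; rewrite -!mulrDr.
by rewrite addrACA -opprD !xyab opprD addrACA.
Qed.

Lemma mxtrace_sqr_sum (K : comNzRingType) d (A : nat -> 'M[K]_d) k :
  \tr ((\sum_(1 <= j < k.+1) A j) *m (\sum_(1 <= j < k.+1) A j)) =
    \sum_(1 <= j < k.+1) \tr (A j *m A j) +
    2 * \sum_(1 <= i < k.+1) \sum_(i.+1 <= j < k.+1) \tr (A i *m A j).
Proof.
elim: k => [|k IHk]; first by rewrite !big_geq // mulr0 addr0 mul0mx mxtrace0.
rewrite (big_nat_recr k.+1) //= [X in _ = X + _](big_nat_recr k.+1) //=.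
rewrite [X in 2 * X](big_nat_recr k.+1) //= [X in 2 * (_ + X)]big_geq // addr0.
have -> : \sum_(1 <= i < k.+1) \sum_(i.+1 <= j < k.+2) \tr (A i *m A j) =
    \sum_(1 <= i < k.+1) \sum_(i.+1 <= j < k.+1) \tr (A i *m A j) +
    \tr ((\sum_(1 <= i < k.+1) A i) *m A k.+1).
  rewrite mulmx_suml linear_sum -big_split /=; apply: eq_big_nat => i.
  by case/andP=> _ ik; rewrite big_nat_recr.
rewrite mulmxDl !mulmxDr !linearD /= IHk (mxtrace_mulC (A k.+1)).
ring.
Qed.

(** * Adjoints and orthogonal projections *)

Section Adjoint.
Variable C : numClosedFieldType.

Lemma adjmxM m n p (A : 'M[C]_(m, n)) (B : 'M[C]_(n, p)) :
  (A *m B)^t* = B^t* *m A^t*.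
Proof. by rewrite trmx_mul map_mxM. Qed.

Lemma adjmxB m n (A B : 'M[C]_(m, n)) : (A - B)^t* = A^t* - B^t*.
Proof. by rewrite linearB map_mxB. Qed.

Lemma adjmx1 n : (1%:M : 'M[C]_n)^t* = 1%:M.
Proof. by rewrite trmx1 map_mx1. Qed.

Lemma hermsymmxP n (A : 'M[C]_n) : reflect (A^t* = A) (A \is hermsymmx).
Proof.
apply: (iffP (is_hermitianmxP _ _ _)); rewrite expr0 scale1r; exact: esym.
Qed.

Lemma adjmx_mul_ge0 n (w : 'cV[C]_n) : 0 <= (w^t* *m w) 0 0.
Proof.
rewrite mxE sumr_ge0 // => k _; rewrite !mxE mulrC; exact: mul_conjC_ge0.
Qed.

Lemma adjmx_mul_eq0 n (w : 'cV[C]_n) : (w^t* *m w) 0 0 <= 0 -> w = 0.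
Proof.
move=> le0; have /eqP : (w^t* *m w) 0 0 = 0.
  by apply/eqP; rewrite eq_le le0 adjmx_mul_ge0.
rewrite mxE psumr_eq0 => [/allP w0|k _]; last first.
  by rewrite !mxE mulrC mul_conjC_ge0.
apply/colP => k; have /= := w0 k (mem_index_enum _).
by rewrite !mxE mulrC mul_conjC_eq0 => /eqP.
Qed.

Definition orthoproj n (P : 'M[C]_n) : Prop := P^t* = P /\ P *m P = P.

Section OrthoProj.
Variable n : nat.
Local Notation "B ^!" :=
  (orthomx Num.conj_op (mx_of_hermitian (hermitian1mx _)) B) : matrix_set_scope.
Implicit Types P Q : 'M[C]_n.

(** The rows of 1 - P are orthogonal to those of P, that is P (1 - P)^* = 0,
    so P = P P^*, which is Hermitian. *)
Lemma orthoproj_proj_ortho m (V : 'M[C]_(m, n)) : orthoproj (proj_ortho V).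
Proof.
set P := proj_ortho V; have PP : P *m P = P by exact: proj_ortho_proj.
split=> //; have /orthomx1P : (P <= (1%:M - 1%:M *m P)^!)%MS.
  rewrite orthomx_sym (submx_trans (proj_ortho_compl_sub _ _)) //.
  by rewrite submx_ortho proj_orthoE.
rewrite mul1mx adjmxB adjmx1 mulmxBr mulmx1 => /subr0_eq PE.
by rewrite [in LHS]PE adjmxM trmxCK -PE.
Qed.

Lemma orthoproj_sub m (B : 'M[C]_(m, n)) P :
  orthoproj P -> (B <= P)%MS <-> B *m P = B.
Proof.
move=> [_ PP]; split=> [/submxP[D ->]|<-]; last exact: submxMl.
by rewrite -mulmxA PP.
Qed.

Lemma orthoproj_eq P Q :
  orthoproj P -> orthoproj Q -> (P <= Q)%MS -> (Q <= P)%MS -> P = Q.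
Proof.
move=> oP oQ /(orthoproj_sub _ oQ) PQ /(orthoproj_sub _ oP) QP.
by rewrite -(proj1 oQ) -QP adjmxM (proj1 oP) (proj1 oQ) PQ.
Qed.

(** Idempotence of a full-rank factorization P = c r forces r c = 1, of size
    the rank of P; then Tr (c r) = Tr (r c). *)
Lemma mxtrace_orthoproj P : orthoproj P -> \tr P = (\rank P)%:R.
Proof.
case=> _; move: (mulmx_base P) (row_base_free P) (col_base_full P).
move: (\rank P) (col_base P) (row_base P) => k c r <- freer.
move=> /row_fullP[c' c'c] crcr.
rewrite mxtrace_mulC (_ : r *m c = 1%:M) ?mxtrace1 //.
apply: (row_free_inj freer); rewrite mul1mx.
by have := congr1 (mulmx c') crcr; rewrite !mulmxA c'c !mul1mx.
Qed.

(** The dimension formula for two subspaces, read through traces. *)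
Lemma mxtrace_orthoproj_adds_cap P Q J M :
  orthoproj P -> orthoproj Q -> orthoproj J -> orthoproj M ->
  (J :=: P + Q)%MS -> (M :=: P :&: Q)%MS -> \tr J + \tr M = \tr P + \tr Q.
Proof.
move=> oP oQ oJ oM JE ME; rewrite !mxtrace_orthoproj // -!natrD.
by rewrite JE ME mxrank_sum_cap.
Qed.

End OrthoProj.
End Adjoint.

(** * Functional calculus *)

Section FunctionalCalculus.
Variables (R : realType) (d : nat).
Local Notation C := R[i].
Implicit Types (A B X P Q : 'M[C]_d) (f g : C -> C).

(** If Q - P is positive, test it on the columns of 1 - Q: this gives
    - |P (1 - Q) e_j|^2 >= 0, hence P (1 - Q) = 0. Conversely, if P Q = P then
    Q - P is itself an orthogonal projection, hence positive. *)
Lemma loewner_le_orthoproj P Q : orthoproj P -> orthoproj Q ->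
  loewner_le P Q <-> (P <= Q)%MS.
Proof.
move=> oP oQ; have [aP PP] := oP; have [aQ QQ] := oQ.
rewrite (orthoproj_sub _ oQ); split=> [[_ pos]|PQ].
  suff PQ0 : P *m (1%:M - Q) = 0.
    by apply/esym/subr0_eq; rewrite -{1}(mulmx1 P) -mulmxBr.
  apply/matrixP => i j; set w := col j (P *m (1%:M - Q)).
  suff w0 : w = 0 by have := congr1 (fun v : 'cV_d => v i 0) w0; rewrite !mxE.
  apply: adjmx_mul_eq0; have := pos (col j (1%:M - Q)).
  rewrite -[((w^t* *m w) 0 0 <= 0)]oppr_ge0; suff -> : (col j (1%:M - Q))^t*
    *m (Q - P) *m col j (1%:M - Q) = - (w^t* *m w) by rewrite mxE.
  have wE : w = P *m col j (1%:M - Q) by rewrite /w !colE mulmxA.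
  have Q0 : Q *m col j (1%:M - Q) = 0.
    by rewrite colE mulmxA mulmxBr mulmx1 QQ subrr mul0mx.
  rewrite wE adjmxM aP !mulmxA -(mulmxA _ P P) PP.
  by rewrite mulmxBr mulmxBl -[X in X - _]mulmxA Q0 mulmx0 sub0r.
have QP : Q *m P = P by rewrite -aP -[in LHS]aQ -adjmxM PQ.
have idem : (Q - P) *m (Q - P) = Q - P.
  by rewrite mulmxBr !mulmxBl QQ QP PQ PP subrr subr0.
have herm : (Q - P)^t* = Q - P by rewrite adjmxB aP aQ.
split=> [|v]; first exact/hermsymmxP.
rewrite -idem mulmxA -{1}herm -adjmxM -mulmxA; exact: adjmx_mul_ge0.
Qed.

Lemma mxfunM f g A :
  mxfun f A *m mxfun g A = mxfun (fun z => f z * g z) A.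
Proof.
rewrite /mxfun; move: (spectralmx A) (spectral_diag A) (spectral_unit A).
move=> U D Uu; rewrite !mulmxA (mulmxK Uu).
rewrite -(mulmxA _ (diag_mx (map_mx f D)) (diag_mx (map_mx g D))) mulmx_diag.
apply: (congr1 (fun E => invmx U *m diag_mx E *m U)).
by apply/rowP => j; rewrite !mxE.
Qed.

Lemma mxfunB f g A : mxfun f A - mxfun g A = mxfun (fun z => f z - g z) A.
Proof.
rewrite /mxfun; move: (spectralmx A) (spectral_diag A) => U D.
have -> : map_mx (fun z => f z - g z) D = map_mx f D - map_mx g D.
  by apply/rowP => j; rewrite !mxE.
by rewrite linearB /= mulmxBr mulmxBl.
Qed.

Lemma mxfunZ a f A : mxfun (fun z => a * f z) A = a *: mxfun f A.
Proof.
rewrite /mxfun; move: (spectralmx A) (spectral_diag A) => U D.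
have -> : map_mx (fun z => a * f z) D = a *: map_mx f D.
  by apply/rowP => j; rewrite !mxE.
by rewrite linearZ /= -scalemxAr -scalemxAl.
Qed.

Lemma eq_mxfun f g A :
  (forall j, f (spectral_diag A 0 j) = g (spectral_diag A 0 j)) ->
  mxfun f A = mxfun g A.
Proof.
rewrite /mxfun; move: (spectralmx A) (spectral_diag A) => U D fg.
apply: (congr1 (fun E => invmx U *m diag_mx E *m U)).
by apply/rowP => j; rewrite !mxE fg.
Qed.

Lemma mxfun_cst a A : mxfun (fun=> a) A = a%:M.
Proof.
rewrite /mxfun (_ : map_mx _ _ = const_mx a); last first.
  by apply/rowP => j; rewrite !mxE.
rewrite diag_const_mx mul_mx_scalar -scalemxAl.
by rewrite mulVmx ?spectral_unit ?scalemx1.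
Qed.

Lemma mxfun_id A : A \is hermsymmx -> mxfun id A = A.
Proof.
move=> hA; rewrite /mxfun map_mx_id //.
exact/esym/orthomx_spectralP/hermitian_normalmx.
Qed.

Lemma mxfun_adj f A : (forall j, f (spectral_diag A 0 j) \is Num.real) ->
  (mxfun f A)^t* = mxfun f A.
Proof.
move=> fr; rewrite /mxfun invmx_unitary ?spectral_unitarymx //.
rewrite !adjmxM trmxCK mulmxA tr_diag_mx map_diag_mx.
apply: (congr1 (fun E => _ *m diag_mx E *m _)).
by apply/rowP => j; rewrite mxE mxE; exact/CrealP.
Qed.

(** f(X) can be computed from any resolution of the identity into eigenblocks
    of X, whether or not the c_i are distinct. With U X = D U the spectral
    decomposition, D (U Q_i) = c_i (U Q_i), so a nonzero entry of U Q_i in row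
    j forces D_j = c_i; therefore f(D) (U Q_i) = f(c_i) (U Q_i), and summing
    over i gives f(D) U. *)
Lemma mxfun_resolution n (c : nat -> C) (Q : nat -> 'M[C]_d) f X :
  X \is hermsymmx -> \sum_(0 <= i < n) Q i = 1%:M ->
  (forall i, (i < n)%N -> X *m Q i = c i *: Q i) ->
  mxfun f X = \sum_(0 <= i < n) f (c i) *: Q i.
Proof.
move=> hX Q1 XQ; have U1 := spectral_unit X.
have UX : spectralmx X *m X = diag_mx (spectral_diag X) *m spectralmx X.
  by rewrite -{2}(mxfun_id hX) /mxfun map_mx_id // -!mulmxA mulKVmx.
rewrite /mxfun -mulmxA; apply: (canLR (mulKmx U1)).
rewrite -[in LHS](mulmx1 (spectralmx X)) -Q1 !mulmx_sumr.
apply: eq_big_nat => i /andP[_ lt_in]; rewrite -scalemxAr.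
have : diag_mx (spectral_diag X) *m (spectralmx X *m Q i)
       = c i *: (spectralmx X *m Q i).
  by rewrite mulmxA -UX -mulmxA XQ // scalemxAr.
set W := spectralmx X *m Q i; rewrite !mul_diag_mx => WE.
apply/matrixP => j k; have := congr1 (fun M : 'M_d => M j k) WE.
rewrite !mxE => /eqP; rewrite -subr_eq0 -mulrBl mulf_eq0.
by case/orP => [/eqP/subr0_eq->|/eqP->]; rewrite ?mulr0.
Qed.

End FunctionalCalculus.

(** * Spectral families with finitely many jumps *)

Section Layers.
Variables (R : realType) (d : nat).
Local Notation C := R[i].
Implicit Types (A B X : 'M[C]_d) (f : C -> C) (s : seq R) (G : R -> 'M[C]_d).

(** The successive values of a decreasing family G with jumps at s_0, s_1, ...:
    it is 1 below s_0, then G(s_0) up to s_1, and so on. *)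
Definition layer_step s G (i : nat) : 'M[C]_d :=
  if i is k.+1 then G s`_k else 1%:M.

(** The jump of the family at the i-th threshold: for G = E_X and s sorted, the
    spectral projection of X for the interval ]s_(i-1), s_i], where s_(-1)
    stands for -oo. *)
Definition layer s G (i : nat) : 'M[C]_d :=
  layer_step s G i - layer_step s G i.+1.

Lemma sum_layer s G k n : (k <= n)%N ->
  \sum_(k <= i < n) layer s G i = layer_step s G k - layer_step s G n.
Proof.
move=> kn; rewrite -[RHS]opprB -telescope_sumr // -sumrN.
by apply: eq_bigr => i _; rewrite opprB.
Qed.

(** The clause sf_dep says that G is constant between consecutive elements of
    s and right-continuous, without mentioning neighbours in s: G t depends
    only on which elements of s exceed t. *)
Record spectral_family s G : Prop := SpectralFamily {
  sf_proj : forall t, orthoproj (G t);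
  sf_anti : forall t t', t <= t' -> (G t' <= G t)%MS;
  sf_dep : forall t t', {in s, forall x, (t < x) = (t' < x)} -> G t = G t';
  sf_bot : forall t, {in s, forall x, x <= t} -> G t = 0;
  sf_top : forall t, {in s, forall x, t < x} -> G t = 1%:M
}.

Section Family.
Variables (s : seq R) (G : R -> 'M[C]_d).
Hypotheses (sorted_s : sorted <=%R s) (famG : spectral_family s G).
Let n := size s.

Lemma nth_threshold_le i j : (i <= j)%N -> (j < n)%N -> s`_i <= s`_j.
Proof.
move=> ij jn; apply: (sorted_leq_nth le_trans le_refl 0 sorted_s) => //.
by rewrite inE (leq_ltn_trans ij jn).
Qed.

Lemma orthoproj_layer_step i : orthoproj (layer_step s G i).
Proof.
case: i => [|i]; last exact: (sf_proj famG).
by rewrite /layer_step /orthoproj adjmx1 mulmx1.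
Qed.

Lemma layer_step_size : layer_step s G n = 0.
Proof.
move: nth_threshold_le (sf_top famG) (sf_bot famG); rewrite /n.
case: s => [|x s'] srt top bot.
  (* Without thresholds, the two boundary conditions give 1 = G 0 = 0. *)
  by rewrite /= -(top 0) // bot.
apply: bot => y /(nthP 0)[i lt_i <-]; exact: srt.
Qed.

Lemma layer_stepM i j : (i <= j <= n)%N ->
  layer_step s G i *m layer_step s G j = layer_step s G j /\
  layer_step s G j *m layer_step s G i = layer_step s G j.
Proof.
move=> /andP[ij jn].
have [ai _] := orthoproj_layer_step i; have [aj _] := orthoproj_layer_step j.
suff ji : layer_step s G j *m layer_step s G i = layer_step s G j.
  by split=> //; rewrite -{1}ai -{1}aj -adjmxM ji aj.
apply/(orthoproj_sub _ (orthoproj_layer_step i)).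
case: i j ij jn {ai aj} => [|i] [|j] //= ij jn; rewrite ?submx1 //.
by apply: (sf_anti famG); apply: nth_threshold_le.
Qed.

(** A decreasing chain of projections has mutually orthogonal jumps. *)
Lemma layerM i j : (i < n)%N -> (j < n)%N ->
  layer s G i *m layer s G j = if i == j then layer s G j else 0.
Proof.
move=> lt_i lt_j; rewrite /layer mulmxBr !mulmxBl.
case: ltngtP => [ij|ji|->].
- have [|-> _] := @layer_stepM i j; first by rewrite (ltnW ij) (ltnW lt_j).
  have [|-> _] := @layer_stepM i.+1 j; first by rewrite ij (ltnW lt_j).
  have [|-> _] := @layer_stepM i j.+1; first by rewrite lt_j leqW // ltnW.
  have [|-> _] := @layer_stepM i.+1 j.+1; first by rewrite lt_j leqW.
  by rewrite !subrr.
- have [|_ ->] := @layer_stepM j i; first by rewrite (ltnW ji) (ltnW lt_i).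
  have [|_ ->] := @layer_stepM j i.+1; first by rewrite lt_i leqW // ltnW.
  have [|_ ->] := @layer_stepM j.+1 i; first by rewrite ji (ltnW lt_i).
  have [|_ ->] := @layer_stepM j.+1 i.+1; first by rewrite lt_i leqW.
  by rewrite subrr.
- have [|-> _] := @layer_stepM j j; first by rewrite leqnn (ltnW lt_j).
  have [|-> ->] := @layer_stepM j j.+1; first by rewrite lt_j leqnSn.
  have [|-> _] := @layer_stepM j.+1 j.+1; first by rewrite lt_j leqnn.
  by rewrite subrr subr0.
Qed.

Lemma sum_layer1 : \sum_(0 <= i < n) layer s G i = 1%:M.
Proof. by rewrite sum_layer // layer_step_size subr0. Qed.

(** The matrix - int t dG(t), as a Stieltjes sum over the jumps of G. *)
Definition family_mx : 'M[C]_d :=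
  \sum_(0 <= i < n) (s`_i)%:C%C *: layer s G i.

Lemma adj_layer i : (layer s G i)^t* = layer s G i.
Proof.
by rewrite adjmxB (proj1 (orthoproj_layer_step _))
   (proj1 (orthoproj_layer_step _)).
Qed.

Lemma family_mx_herm : family_mx \is hermsymmx.
Proof.
apply/hermsymmxP; rewrite /family_mx linear_sum /= map_mx_sum.
apply: eq_bigr => i _; rewrite linearZ map_mxZ adj_layer; congr (_ *: _).
by apply/CrealP; rewrite complex_real.
Qed.

Lemma mxfun_family_mx f :
  mxfun f family_mx = \sum_(0 <= i < n) f (s`_i)%:C%C *: layer s G i.
Proof.
apply: (mxfun_resolution (c := fun i => (s`_i)%:C%C)) => [||j lt_j].
- exact: family_mx_herm.
- exact: sum_layer1.
rewrite /family_mx mulmx_suml (eq_big_nat _ _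
  (F2 := fun i => if i == j then (s`_j)%:C%C *: layer s G j else 0)).
  by rewrite -big_mkcond big_nat1_eq /= lt_j.
move=> i /andP[_ lt_i]; rewrite -scalemxAl layerM //.
by case: eqP => [->|_]; rewrite ?scaler0.
Qed.

(** The layers above t telescope to E_k, where k is the index of the first
    threshold exceeding t, and G takes this value at t. *)
Lemma specproj_family_mx t : specproj family_mx t = G t.
Proof.
rewrite /specproj mxfun_family_mx; pose k := find (> t) s.
have kn : (k <= n)%N by exact: find_size.
have lek i : (i < k)%N -> s`_i <= t.
  by move=> /(before_find 0) /negbT; rewrite -leNgt.
have ltk i : (k <= i)%N -> (i < n)%N -> t < s`_i.
  move=> ki lt_i; apply: lt_le_trans (nth_threshold_le ki lt_i).
  by apply: (nth_find 0 (a := > t)); rewrite has_find (leq_ltn_trans ki).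
rewrite (big_cat_nat (n := k)) //= [X in X + _]big_nat [X in X + _]big1.
  rewrite add0r (eq_big_nat _ _ (F2 := layer s G)); last first.
    by move=> i /andP[ki lt_i]; rewrite ltcR ltk // scale1r.
  rewrite sum_layer // layer_step_size subr0.
  case: (k) kn lek ltk => [|k'] kn lek ltk.
    by rewrite (sf_top famG) // => x /(nthP 0)[i lt_i <-]; apply: ltk.
  apply: (sf_dep famG) => x /(nthP 0)[i lt_i <-].
  have [ki|ik] := ltnP k' i.
    rewrite (ltk _ ki lt_i); apply: le_lt_trans (ltk _ ki lt_i); exact: lek.
  rewrite [RHS]ltNge lek // ltNge nth_threshold_le //.
by move=> i /lek ti; rewrite ltcR ltNge ti scale0r.
Qed.

End Family.
End Layers.

(** * Layer decomposition of a Hermitian matrix *)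

Section SpectralOrderLattice.
Variables (R : realType) (d : nat).
Local Notation C := R[i].
Implicit Types (A B X Y J M : 'M[C]_d) (f : C -> C) (s : seq R).

Definition eigvals A : seq R :=
  [seq complex.Re (spectral_diag A 0 j) | j <- enum 'I_d].

Lemma eigvalsP A : A \is hermsymmx -> forall j,
  exists2 x, x \in eigvals A & spectral_diag A 0 j = x%:C%C.
Proof.
move=> hA j; exists (complex.Re (spectral_diag A 0 j)).
  by apply: map_f; rewrite mem_enum.
by rewrite RRe_real // (mxOverP (hermitian_spectral_diag_real hA)).
Qed.

Definition thresholds (As : seq 'M[C]_d) : seq R :=
  sort <=%R (flatten [seq eigvals A | A <- As]).

Lemma sorted_thresholds As : sorted <=%R (thresholds As).
Proof. exact/sort_sorted/le_total. Qed.

Lemma eigvals_thresholds As k :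
  (k < size As)%N -> {subset eigvals As`_k <= thresholds As}.
Proof.
move=> lt_k x xk; rewrite mem_sort; apply/flattenP; exists (eigvals As`_k) => //.
by apply: map_f; apply: mem_nth.
Qed.

Lemma specproj_orthoproj A t : orthoproj (specproj A t).
Proof.
split; first by apply: mxfun_adj => j; case: ifP; rewrite ?rpred0 ?rpred1.
by rewrite mxfunM; apply: eq_mxfun => j /=; case: ifP; rewrite ?mulr0 ?mulr1.
Qed.

Lemma spectral_family_specproj A s : A \is hermsymmx ->
  {subset eigvals A <= s} -> spectral_family s (specproj A).
Proof.
move=> /eigvalsP eigA subs; split.
- exact: specproj_orthoproj.
- move=> t t' tt'; apply/(orthoproj_sub _ (specproj_orthoproj _ _)).
  rewrite mxfunM; apply: eq_mxfun => j /=; have [x _ ->] := eigA j.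
  rewrite !ltcR; case: ltP => t'x; rewrite ?mul0r //.
  by rewrite (le_lt_trans tt' t'x) mulr1.
- move=> t t' dep; apply: eq_mxfun => j; have [x /subs xs ->] := eigA j.
  by rewrite !ltcR dep.
- move=> t bot; transitivity (mxfun (fun=> 0) A); last first.
    by rewrite mxfun_cst raddf0.
  apply: eq_mxfun => j; have [x /subs xs ->] := eigA j.
  by rewrite ltcR ltNge bot.
- move=> t top; rewrite -(mxfun_cst 1 A) /specproj.
  apply: eq_mxfun => j; have [x /subs xs ->] := eigA j.
  by rewrite ltcR top.
Qed.

(** The i-th layer of A is the function of A given by the indicator of
    ]s_(i-1), s_i], with s_(-1) = -oo. Elements of s in this interval are equal
    to s_i, so A acts on the layer as the scalar s_i. *)
Lemma mxfun_layers A s f : A \is hermsymmx -> sorted <=%R s ->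
  {subset eigvals A <= s} ->
  mxfun f A =
    \sum_(0 <= i < size s) f (s`_i)%:C%C *: layer s (specproj A) i.
Proof.
move=> hA srt subs; have famA := spectral_family_specproj hA subs.
apply: (mxfun_resolution (c := fun i => (s`_i)%:C%C)) => // [|i lt_i].
  exact: sum_layer1.
pose ind k (z : C) : C :=
  if k is k'.+1 then if (s`_k')%:C%C < z then 1 else 0 else 1.
have stepE k : layer_step s (specproj A) k = mxfun (ind k) A.
  by case: k => [|k] //=; rewrite mxfun_cst.
rewrite /layer !stepE mxfunB -mxfunZ -[X in X *m _](mxfun_id hA) mxfunM.
apply: eq_mxfun => j /=; have [x /subs xs ->] := eigvalsP hA j.
rewrite ltcR; case: (ltP s`_i x) => [six|xsi].
  suff -> : ind i x%:C%C = 1 by rewrite subrr !mulr0.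
  case: i lt_i six => [|i] lt_i six //=; rewrite ltcR (le_lt_trans _ six) //.
  exact: (nth_threshold_le srt).
case: i lt_i xsi => [|i] lt_i xsi /=.
  suff -> : x = s`_0 by [].
  apply/eqP; rewrite eq_le xsi; case/(nthP 0): xs => k lt_k <-.
  exact: (nth_threshold_le srt).
rewrite ltcR; case: ltP => [six|]; last by rewrite subrr !mulr0.
suff -> : x = s`_i.+1 by [].
apply/eqP; rewrite eq_le xsi; case/(nthP 0): xs six => k lt_k <- sik.
apply: (nth_threshold_le srt) => //; rewrite ltnNge; apply/negP => ki.
by have := nth_threshold_le srt ki (ltnW lt_i); rewrite leNgt sik.
Qed.

(** * The spectral order as a lattice *)

(** The row-space form of the spectral order, which reduces suprema and infima
    to sums and intersections of subspaces. *)
Lemma spec_leP A B :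
  spec_le A B <-> forall t, (specproj A t <= specproj B t)%MS.
Proof.
by split=> le t; have := le t;
  rewrite loewner_le_orthoproj //; exact: specproj_orthoproj.
Qed.

Lemma spec_le_trans A B X : spec_le A B -> spec_le B X -> spec_le A X.
Proof.
rewrite !spec_leP => AB BX t; exact: submx_trans (AB t) (BX t).
Qed.

(** By the layer formula for the identity function, taken on thresholds common
    to A and B, a Hermitian matrix is recovered from its projections. *)
Lemma spec_le_anti A B : A \is hermsymmx -> B \is hermsymmx ->
  spec_le A B -> spec_le B A -> A = B.
Proof.
move=> hA hB /spec_leP AB /spec_leP BA.
have EAB t : specproj A t = specproj B t.
  by apply: orthoproj_eq => //; exact: specproj_orthoproj.
pose s := thresholds [:: A; B]; have srt : sorted <=%R s.
  exact: sorted_thresholds.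
have sA : {subset eigvals A <= s} := @eigvals_thresholds [:: A; B] 0 isT.
have sB : {subset eigvals B <= s} := @eigvals_thresholds [:: A; B] 1 isT.
rewrite -(mxfun_id hA) -(mxfun_id hB) (mxfun_layers _ hA srt sA).
rewrite (mxfun_layers _ hB srt sB); apply: eq_bigr => i _.
by case: i => [|i]; rewrite /layer /= !EAB.
Qed.

(** Replacing each V t by the orthogonal projection onto it gives a spectral
    family. *)
Lemma specproj_realize s (V : R -> 'M[C]_d) :
  (forall t t', t <= t' -> (V t' <= V t)%MS) ->
  (forall t t', {in s, forall x, (t < x) = (t' < x)} -> V t = V t') ->
  (forall t, {in s, forall x, x <= t} -> V t = 0) ->
  (forall t, {in s, forall x, t < x} -> (V t :=: 1%:M)%MS) ->
  exists2 X, X \is hermsymmx & forall t, (specproj X t :=: V t)%MS.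
Proof.
move=> anti dep bot top; pose s' := sort <=%R s; pose G t := proj_ortho (V t).
have srt : sorted <=%R s' by exact/sort_sorted/le_total.
have famG : spectral_family s' G.
  split.
  - by move=> t; exact: orthoproj_proj_ortho.
  - by move=> t t' tt'; rewrite !proj_orthoE anti.
  - move=> t t' tt'; congr proj_ortho; apply: dep => x xs.
    by apply: tt'; rewrite mem_sort.
  - move=> t bt; apply/eqP; rewrite -submx0 proj_orthoE bot ?submx0 // => x xs.
    by apply: bt; rewrite mem_sort.
  - move=> t tt'; apply: orthoproj_eq; rewrite ?submx1 //.
    + exact: orthoproj_proj_ortho.
    + by split; rewrite ?adjmx1 ?mulmx1.
    + rewrite proj_orthoE top // => x xs; by apply: tt'; rewrite mem_sort.
exists (family_mx s' G); first exact: family_mx_herm.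
by move=> t; rewrite specproj_family_mx //; exact: proj_orthoE.
Qed.

Lemma exists_spec_join A B : A \is hermsymmx -> B \is hermsymmx ->
  exists2 J, J \is hermsymmx &
    forall t, (specproj J t :=: specproj A t + specproj B t)%MS.
Proof.
move=> hA hB; pose s := thresholds [:: A; B].
have [_ aA dA bA tA] : spectral_family s (specproj A) :=
  spectral_family_specproj hA (@eigvals_thresholds [:: A; B] 0 isT).
have [_ aB dB bB tB] : spectral_family s (specproj B) :=
  spectral_family_specproj hB (@eigvals_thresholds [:: A; B] 1 isT).
apply: (@specproj_realize s).
- by move=> t t' tt'; exact: addsmxS (aA _ _ tt') (aB _ _ tt').
- by move=> t t' tt'; rewrite (dA t t' tt') (dB t t' tt').
- by move=> t tt'; rewrite (bA t tt') (bB t tt') adds0mx_id.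
- by move=> t tt'; rewrite (tA t tt') (tB t tt');
  exact: addsmx_idPl (submx_refl _).
Qed.

Lemma exists_spec_meet A B : A \is hermsymmx -> B \is hermsymmx ->
  exists2 M, M \is hermsymmx &
    forall t, (specproj M t :=: specproj A t :&: specproj B t)%MS.
Proof.
move=> hA hB; pose s := thresholds [:: A; B].
have [_ aA dA bA tA] : spectral_family s (specproj A) :=
  spectral_family_specproj hA (@eigvals_thresholds [:: A; B] 0 isT).
have [_ aB dB bB tB] : spectral_family s (specproj B) :=
  spectral_family_specproj hB (@eigvals_thresholds [:: A; B] 1 isT).
apply: (@specproj_realize s).
- by move=> t t' tt'; exact: capmxS (aA _ _ tt') (aB _ _ tt').
- by move=> t t' tt'; rewrite (dA t t' tt') (dB t t' tt').
- by move=> t tt'; rewrite (bA t tt') cap0mx.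
- by move=> t tt'; rewrite (tA t tt') (tB t tt');
  exact: capmx_idPl (submx_refl _).
Qed.

Lemma is_spec_sup_unique F X Y : is_spec_sup F X -> is_spec_sup F Y -> X = Y.
Proof.
move=> [hX uX lX] [hY uY lY].
exact: (spec_le_anti hX hY (lX Y hY uY) (lY X hX uX)).
Qed.

Lemma is_spec_inf_unique F X Y : is_spec_inf F X -> is_spec_inf F Y -> X = Y.
Proof.
move=> [hX uX lX] [hY uY lY].
exact: (spec_le_anti hX hY (lY X hX uX) (lX Y hY uY)).
Qed.

Lemma spec_supE F X : is_spec_sup F X -> spec_sup F = X.
Proof.
move=> supX; apply: (xget_unique 0 supX) => Y supY.
exact: (is_spec_sup_unique supY supX).
Qed.

Lemma spec_infE F X : is_spec_inf F X -> spec_inf F = X.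
Proof.
move=> infX; apply: (xget_unique 0 infX) => Y infY.
exact: (is_spec_inf_unique infY infX).
Qed.

Lemma spec_joinP A B : A \is hermsymmx -> B \is hermsymmx ->
  is_spec_sup [set A; B] (spec_join A B) /\
  forall t, (specproj (spec_join A B) t :=: specproj A t + specproj B t)%MS.
Proof.
move=> hA hB; have [J hJ JE] := exists_spec_join hA hB.
suff supJ : is_spec_sup [set A; B] J.
  by rewrite /spec_join (spec_supE supJ); exact: conj.
split; first exact: hJ.
- move=> X [] ->; apply/spec_leP => t; rewrite JE.
  + exact: addsmxSl.
  + exact: addsmxSr.
- move=> Y hY ub; apply/spec_leP => t; rewrite JE addsmx_sub.
  have /spec_leP AY := ub A (or_introl erefl).
  by have /spec_leP BY := ub B (or_intror erefl); rewrite AY BY.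
Qed.

Lemma spec_meetP A B : A \is hermsymmx -> B \is hermsymmx ->
  is_spec_inf [set A; B] (spec_meet A B) /\
  forall t, (specproj (spec_meet A B) t :=: specproj A t :&: specproj B t)%MS.
Proof.
move=> hA hB; have [M hM ME] := exists_spec_meet hA hB.
suff infM : is_spec_inf [set A; B] M.
  by rewrite /spec_meet (spec_infE infM); exact: conj.
split; first exact: hM.
- move=> X [] ->; apply/spec_leP => t; rewrite ME.
  + exact: capmxSl.
  + exact: capmxSr.
- move=> Y hY lb; apply/spec_leP => t; rewrite ME sub_capmx.
  have /spec_leP YA := lb A (or_introl erefl).
  by have /spec_leP YB := lb B (or_intror erefl); rewrite YA YB.
Qed.

(** Lets the supremum of a family be built one element at a time. *)
Lemma is_spec_sup_join F X A : is_spec_sup F X -> A \is hermsymmx ->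
  is_spec_sup (F `|` [set A]) (spec_join X A).
Proof.
move=> [hX ubX lubX] hA; have [[hJ ubJ lubJ] _] := spec_joinP hX hA.
split; first exact: hJ.
- move=> Y [FY|->].
  + exact: (spec_le_trans (ubX Y FY) (ubJ X (or_introl erefl))).
  + exact: (ubJ A (or_intror erefl)).
- move=> Y hY ubY; apply: (lubJ Y hY) => Z [] ->.
  + by apply: (lubX Y hY) => Z' FZ'; apply: ubY; left.
  + by apply: ubY; right.
Qed.

(** On thresholds common to A, B, the join and the meet, both sides are the same
    linear combination of the ranks of the projections at the thresholds, and
    these ranks satisfy rk (U + V) + rk (U :&: V) = rk U + rk V. *)
Lemma mxtrace_join_meet f A B : A \is hermsymmx -> B \is hermsymmx ->
  \tr (mxfun f (spec_join A B)) + \tr (mxfun f (spec_meet A B)) =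
  \tr (mxfun f A) + \tr (mxfun f B).
Proof.
move=> hA hB; have [[hJ _ _] JE] := spec_joinP hA hB.
have [[hM _ _] ME] := spec_meetP hA hB.
move: (spec_join A B) (spec_meet A B) hJ hM JE ME => J M hJ hM JE ME.
pose As := [:: A; B; J; M]; pose s := thresholds As.
pose r X k := \tr (layer_step s (specproj X) k).
have layE X : X \is hermsymmx -> {subset eigvals X <= s} -> \tr (mxfun f X) =
    \sum_(0 <= i < size s) f (s`_i)%:C%C * (r X i - r X i.+1).
  move=> hX sX; rewrite (mxfun_layers _ hX (sorted_thresholds As) sX).
  rewrite linear_sum /=; apply: eq_bigr => i _; rewrite mxtraceZ.
  by congr (_ * _); exact: raddfB.
have rE k : r J k + r M k = r A k + r B k.
  rewrite /r; case: k => [|k] /=; first exact: erefl.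
  have oE X := specproj_orthoproj X s`_k.
  exact: (mxtrace_orthoproj_adds_cap (oE A) (oE B) (oE J) (oE M)).
have lA := layE A hA (@eigvals_thresholds As 0 isT).
have lB := layE B hB (@eigvals_thresholds As 1 isT).
have lJ := layE J hJ (@eigvals_thresholds As 2 isT).
have lM := layE M hM (@eigvals_thresholds As 3 isT).
apply: etrans (congr2 +%R lJ lM) _; apply: etrans (esym (congr2 +%R lA lB)).
exact: sum_jumpsD.
Qed.

(** * Hilbert-Schmidt norms *)

Lemma hsnormE A : A \is hermsymmx -> hsnorm A ^+ 2 = \tr (A *m A).
Proof. by move=> /hermsymmxP hA; rewrite /hsnorm sqrtCK hA. Qed.

Lemma hsnorm_join_meet A B : A \is hermsymmx -> B \is hermsymmx ->
  hsnorm (spec_join A B) ^+ 2 + hsnorm (spec_meet A B) ^+ 2 =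
  hsnorm A ^+ 2 + hsnorm B ^+ 2.
Proof.
move=> hA hB; have [[hJ _ _] _] := spec_joinP hA hB.
have [[hM _ _] _] := spec_meetP hA hB.
have sqE X : X \is hermsymmx -> hsnorm X ^+ 2 = \tr (mxfun (fun z => z * z) X).
  by move=> hX; rewrite (hsnormE hX) -(mxfunM id id) (mxfun_id hX).
apply: etrans (congr2 +%R (sqE _ hJ) (sqE _ hM)) _.
apply: etrans (esym (congr2 +%R (sqE _ hA) (sqE _ hB))).
exact: mxtrace_join_meet.
Qed.

(** The eigenvalue is the value of the quadratic form of A at the j-th spectral
    eigenvector. *)
Lemma psdmx_eigval_ge0 A j : psdmx A -> 0 <= spectral_diag A 0 j.
Proof.
move=> [hA pos]; have Uu := spectral_unitarymx A; have := mxfun_id hA.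
rewrite /mxfun (map_mx_id (fun _ => erefl)) (invmx_unitary Uu).
move: (spectralmx A) (spectral_diag A) Uu => U D /unitarymxP UU AE.
have UUj : U *m (row j U)^t* = delta_mx j 0.
  by rewrite rowE adjmxM mulmxA UU mul1mx trmx_delta map_delta_mx.
have jUU : row j U *m U^t* = delta_mx 0 j by rewrite rowE -mulmxA UU mulmx1.
have := pos ((row j U)^t* ); rewrite trmxCK -AE !mulmxA jUU.
rewrite -(mulmxA _ U) UUj -rowE mxE.
by rewrite (bigD1 j) //= !mxE !eqxx mulr1n mulr1 big1 ?addr0 // => k /negPf kj;
  rewrite !mxE kj mulr0.
Qed.

Lemma sqrtmx_herm A : psdmx A -> (sqrtmx A)^t* = sqrtmx A.
Proof.
move=> pA; apply: mxfun_adj => j.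
by rewrite ger0_real // sqrtC_ge0 psdmx_eigval_ge0.
Qed.

Lemma sqrtmx_sq A : psdmx A -> sqrtmx A *m sqrtmx A = A.
Proof.
move=> [hA _]; rewrite mxfunM -[RHS](mxfun_id hA).
by apply: eq_mxfun => j; rewrite -expr2 sqrtCK.
Qed.

Lemma hsnorm_sqrtmx A B : psdmx A -> psdmx B ->
  hsnorm (sqrtmx A *m sqrtmx B) ^+ 2 = \tr (A *m B).
Proof.
move=> pA pB; rewrite /hsnorm sqrtCK.
move: (sqrtmx_herm pA) (sqrtmx_herm pB) (sqrtmx_sq pA) (sqrtmx_sq pB).
move: (sqrtmx A) (sqrtmx B) => P Q aP aQ <- <-.
by rewrite adjmxM aP aQ -mulmxA mxtrace_mulC !mulmxA.
Qed.

Lemma herm_sum (I : Type) (r : seq I) (P : pred I) (F : I -> 'M[C]_d) :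
  (forall i, P i -> F i \is hermsymmx) -> \sum_(i <- r | P i) F i \is hermsymmx.
Proof.
move=> hF; apply/hermsymmxP; rewrite linear_sum /= map_mx_sum.
by apply: eq_bigr => i /hF /hermsymmxP.
Qed.

Lemma hsnorm_sum (A : nat -> 'M[C]_d) k :
  (forall j, (1 <= j <= k)%N -> A j \is hermsymmx) ->
  hsnorm (\sum_(1 <= j < k.+1) A j) ^+ 2 =
    \sum_(1 <= j < k.+1) hsnorm (A j) ^+ 2 +
    2 * \sum_(1 <= i < k.+1) \sum_(i.+1 <= j < k.+1) \tr (A i *m A j).
Proof.
move=> hA; have hS : \sum_(1 <= j < k.+1) A j \is hermsymmx.
  rewrite big_nat_cond; apply: herm_sum => j /andP[jk _]; exact: hA.
apply: etrans (hsnormE hS) _; apply: etrans (mxtrace_sqr_sum A k) _.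
apply: (congr1 (+%R^~ _)); apply: eq_big_nat => j jk.
exact: esym (hsnormE (hA j jk)).
Qed.

End SpectralOrderLattice.

Theorem mainTheorem7 (R : realType) (d m : nat) (A C D : nat -> 'M[R[i]]_d)
  (hm : (2 <= m)%N)
  (hA : forall j, (1 <= j <= m)%N -> psdmx (A j))
  (hC1 : C 1%N = A 1%N)
  (hC : forall j, (2 <= j <= m)%N -> C j = spec_join (C j.-1) (A j))
  (hD : forall j, (2 <= j <= m)%N -> D j = spec_meet (C j.-1) (A j)) :
  let S := \sum_(1 <= j < m.+1) A j in
  C m = spec_sup [set A j | j in [set j | (1 <= j <= m)%N]] /\
  hsnorm S ^+ 2 - hsnorm (C m) ^+ 2 =
    \sum_(2 <= j < m.+1) hsnorm (D j) ^+ 2 +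
    2 * \sum_(1 <= i < m.+1) \sum_(i.+1 <= j < m.+1)
          hsnorm (sqrtmx (A i) *m sqrtmx (A j)) ^+ 2.
Proof.
have herm j : (1 <= j <= m)%N -> A j \is hermsymmx by move=> /hA[].
(* Induction on the number k.+1 of matrices: C k.+1 is their supremum, and the
   squared norms telescope through the join-meet identity. *)
have ind k : (k < m)%N ->
    is_spec_sup [set A j | j in [set j | (1 <= j <= k.+1)%N]] (C k.+1) /\
    \sum_(1 <= j < k.+2) hsnorm (A j) ^+ 2 - hsnorm (C k.+1) ^+ 2 =
    \sum_(2 <= j < k.+2) hsnorm (D j) ^+ 2.
  elim: k => [|k IHk] km.
    rewrite hC1 big_nat1 subrr big_geq //; split; last exact: erefl.
    split=> [|_ [j /= j1 <-]|Y hY]; first exact: (herm 1%N km).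
      by rewrite -(anti_leq j1); apply/spec_leP => t; exact: submx_refl.
    by apply; exists 1%N.
  have {IHk}[supk sumk] := IHk (ltnW km).
  have hCk : C k.+1 \is hermsymmx by case: supk.
  have hAk : A k.+2 \is hermsymmx := herm k.+2 km.
  rewrite (hC k.+2 km); split.
    suff -> : [set A j | j in [set j | (1 <= j <= k.+2)%N]] =
        [set A j | j in [set j | (1 <= j <= k.+1)%N]] `|` [set A k.+2].
      exact: is_spec_sup_join.
    apply/seteqP; split=> [_ [j /= /andP[j1 jk] <-]|
                           _ [[j /= /andP[j1 jk] <-]|->]].
    - have [jk1|kj] := leqP j k.+1; first by left; exists j; rewrite //= j1.
      by right; rewrite (_ : j = k.+2) //; apply/eqP; rewrite eqn_leq jk.
    - by exists j; rewrite //= j1 leqW.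
    - by exists k.+2; rewrite //= leqnn.
  rewrite (big_nat_recr k.+2) //= [RHS](big_nat_recr k.+2) //=.
  rewrite -sumk (hD k.+2 km).
  exact: (subr_exchange _ (hsnorm_join_meet hCk hAk)).
have [k mE] : exists k, m = k.+1 by case: (m) hm => // k _; exists k.
have [sup sumE] : is_spec_sup [set A j | j in [set j | (1 <= j <= m)%N]] (C m) /\
    \sum_(1 <= j < m.+1) hsnorm (A j) ^+ 2 - hsnorm (C m) ^+ 2 =
    \sum_(2 <= j < m.+1) hsnorm (D j) ^+ 2.
  by have := ind k; rewrite -mE; apply; rewrite mE.
move=> S; split; first exact: esym (spec_supE sup).
apply: etrans (congr1 (+%R^~ _) (hsnorm_sum herm)) _.
apply: etrans (addrAC _ _ _) _; rewrite sumE.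
apply: (congr1 (fun x => _ + 2 * x)).
apply: eq_big_nat => i /andP[i1 im]; apply: eq_big_nat => j /andP[ij jm].
have iA := hA i (introT andP (conj i1 im)).
have jA := hA j (introT andP (conj (leq_trans i1 (ltnW ij)) jm)).
exact: esym (hsnorm_sqrtmx iA jA).
Qed.
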